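(* Let $\mathbf{A}\in\mathbb{C}^{N\times N}$ be Hermitian and nonsingular (possibly indefinite), let $\mathbf{b}\in\mathbb{C}^N$, let $\mathbf{U}\in\mathbb{C}^{N\times k}$ have rank $k$, where $0<k<N$, and set $$\mathbf{M}_{\mathbf{A}}:=\mathbf{U}(\mathbf{U}^{\mathsf H}\mathbf{A}^2\mathbf{U})^{-1}\mathbf{U}^{\mathsf H},\qquad \mathbf{P}_{\mathbf{A}}:=\mathbf{I}-\mathbf{A}\mathbf{M}_{\mathbf{A}}\mathbf{A},\qquad \mathbf{Q}_{\mathbf{A}}:=\mathbf{I}-\mathbf{M}_{\mathbf{A}}\mathbf{A}^2.$$ For each initial guess $\mathbf{x}_0\in\mathbb{C}^N$ the MINRES method applied to the system $$\mathbf{P}_{\mathbf{A}}\mathbf{A}\mathbf{P}_{\mathbf{A}}\mathbf{x}=\mathbf{P}_{\mathbf{A}}\mathbf{Q}_{\mathbf{A}}^{\mathsf H}\mathbf{b}$$ yields (in exact arithmetic) a well-defined iterate $\overline{\mathbf{x}}_n$ at every step $n\ge1$ until it terminates with a solution. Moreover, the sequence of iterates $$\mathbf{x}_n:=\mathbf{Q}_{\mathbf{A}}\left(\mathbf{P}_{\mathbf{A}}\overline{\mathbf{x}}_n+\mathbf{A}\mathbf{M}_{\mathbf{A}}\mathbf{b}\right)+\mathbf{M}_{\mathbf{A}}\mathbf{A}\mathbf{b}$$ is well defined, it terminates (in exact arithmetic) with the exact solution $\mathbf{x}$ of the original linear system $\mathbf{A}\mathbf{x}=\mathbf{b}$, and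 its residuals are given by $$\mathbf{r}_n=\mathbf{b}-\mathbf{A}\mathbf{x}_n=\mathbf{P}_{\mathbf{A}}\mathbf{Q}_{\mathbf{A}}^{\mathsf H}\mathbf{b}-\mathbf{P}_{\mathbf{A}}\mathbf{A}\mathbf{P}_{\mathbf{A}}\overline{\mathbf{x}}_n.$$
   Context: For $\mathbf{C}\in\mathbb{C}^{N\times N}$ and $\mathbf{v}\in\mathbb{C}^N$, $\mathcal{K}_n(\mathbf{C},\mathbf{v}):=\mathrm{span}\{\mathbf{v},\mathbf{C}\mathbf{v},\dots,\mathbf{C}^{n-1}\mathbf{v}\}$, with $\mathcal{K}_0=\{\mathbf{0}\}$; $\perp$ is Euclidean orthogonality in $\mathbb{C}^N$. MINRES (in exact arithmetic) applied to a linear system $\mathbf{C}\mathbf{z}=\mathbf{c}$ with Hermitian (possibly singular) matrix $\mathbf{C}$ and initial guess $\mathbf{z}_0$, with initial residual $\mathbf{s}_0=\mathbf{c}-\mathbf{C}\mathbf{z}_0$, is mathematically characterized as follows. Its $n$-th iterate $\mathbf{z}_n$ is determined by $$\mathbf{z}_n\in\mathbf{z}_0+\mathcal{K}_n(\mathbf{C},\mathbf{s}_0),\qquad \mathbf{c}-\mathbf{C}\mathbf{z}_n\perp\mathbf{C}\mathcal{K}_n(\mathbf{C},\mathbf{s}_0),$$ equivalently, $\mathbf{z}_n$ minimizes $\|\mathbf{c}-\mathbf{C}\mathbf{y}\|_2$ over $\mathbf{y}\in\mathbf{z}_0+\mathcal{K}_n(\mathbf{C},\mathbf{s}_0)$.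 Let $d\ge0$ be the smallest integer with $\mathcal{K}_{d+1}(\mathbf{C},\mathbf{s}_0)=\mathcal{K}_d(\mathbf{C},\mathbf{s}_0)$. The iteration runs over $n=1,\dots,d$ and terminates at step $d$ (if $d=0$, then $\mathbf{z}_0$ is already a solution). The iterate is well defined at step $n$ if there is exactly one vector $\mathbf{z}_n$ satisfying both $\mathbf{z}_n\in\mathbf{z}_0+\mathcal{K}_n(\mathbf{C},\mathbf{s}_0)$ and $\mathbf{c}-\mathbf{C}\mathbf{z}_n\perp\mathbf{C}\mathcal{K}_n(\mathbf{C},\mathbf{s}_0)$; the method terminates with a solution if $\mathbf{z}_d$ solves $\mathbf{C}\mathbf{z}=\mathbf{c}$. *)

(* Defs.v *)
From mathcomp Require Import all_boot all_order all_algebra.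
From mathcomp Require Import spectral sesquilinear.
From mathcomp Require Import reals complex.

Set Implicit Arguments.
Unset Strict Implicit.
Unset Printing Implicit Defensive.

Import Order.TTheory GRing.Theory Num.Theory.
Local Open Scope ring_scope.
Local Open Scope sesquilinear_scope.

(* Everything is written over an arbitrary numClosedFieldType F, where
   M ^t* is the conjugate transpose; the complex numbers are F := R[i] with
   R : realType. Vectors are column vectors. *)

Definition orthocv (F : numClosedFieldType) (N : nat) (u v : 'cV[F]_N) : Prop :=
  v ^t* *m u = 0.

Definition krylov (F : numClosedFieldType) (N : nat)
    (C : 'M[F]_N) (v : 'cV[F]_N) (n : nat) : {vspace 'cV[F]_N} :=
  <<[seq C ^+ i *m v | i <- iota 0 n]>>%VS.

Definition krylov_grade (F : numClosedFieldType) (N : nat)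
    (C : 'M[F]_N) (v : 'cV[F]_N) (d : nat) : Prop :=
  krylov C v d.+1 = krylov C v d
  /\ forall m : nat, krylov C v m.+1 = krylov C v m -> (d <= m)%N.

Section Minres.
Variables (F : numClosedFieldType) (N : nat).
Variables (C : 'M[F]_N) (c z0 : 'cV[F]_N).

Definition minres_iterate (n : nat) (z : 'cV[F]_N) : Prop :=
  let K := krylov C (c - C *m z0) n in
  z - z0 \in K
  /\ forall y : 'cV[F]_N, y \in K -> orthocv (c - C *m z) (C *m y).

Definition minres_last (d : nat) : Prop := krylov_grade C (c - C *m z0) d.

Definition minres_well_defined (n : nat) : Prop :=
  exists! z : 'cV[F]_N, minres_iterate n z.

(* z lists the initial guess z 0 = z0 and the iterates z 1, ..., z d; its
   values beyond the terminal step d are irrelevant. *)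
Definition minres_run (d : nat) (z : nat -> 'cV[F]_N) : Prop :=
  z 0%N = z0 /\ forall n : nat, (1 <= n <= d)%N -> minres_iterate n (z n).
End Minres.

Section Deflation.
Variables (F : numClosedFieldType) (N k : nat).
Variables (A : 'M[F]_N) (U : 'M[F]_(N, k)).

(* invmx is total: it is a genuine inverse only on unitmx. *)
Definition deflG : 'M[F]_k := U ^t* *m A ^+ 2 *m U.
Definition deflM : 'M[F]_N := U *m invmx deflG *m U ^t*.
Definition deflP : 'M[F]_N := 1%:M - A *m deflM *m A.
Definition deflQ : 'M[F]_N := 1%:M - deflM *m A ^+ 2.

Definition defl_matrix : 'M[F]_N := deflP *m A *m deflP.
Definition defl_rhs (b : 'cV[F]_N) : 'cV[F]_N := deflP *m deflQ ^t* *m b.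

Definition defl_correct (b xbar : 'cV[F]_N) : 'cV[F]_N :=
  deflQ *m (deflP *m xbar + A *m deflM *m b) + deflM *m A *m b.
End Deflation.

(* Main.v *)
(* With B = P A P Hermitian and Q^H A = A P, the right-hand side P Q^H b equals
   B (A^{-1} b), so the deflated system is consistent although B is singular.
   Hence the initial residual and all Krylov spaces lie in the range of B, where
   a Hermitian B is injective; this makes every least-squares iterate unique and
   rules out breakdown.  The residual identity follows from A Q = P A. *)

Require Import Defs.
From mathcomp Require Import all_boot all_order all_algebra.
From mathcomp Require Import spectral sesquilinear.
From mathcomp Require Import reals complex.

Set Implicit Arguments.
Unset Strict Implicit.
Unset Printing Implicit Defensive.

Import Order.TTheory GRing.Theory Num.Theory.
Local Open Scope ring_scope.
Local Open Scope sesquilinear_scope.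
Local Open Scope complex_scope.

(** * Conjugate transposes and Gram matrices *)

Lemma trmxC_mul (F : numClosedFieldType) m n p (X : 'M[F]_(m, n))
    (Y : 'M[F]_(n, p)) :
  (X *m Y) ^t* = Y ^t* *m X ^t*.
Proof. by rewrite trmx_mul map_mxM. Qed.

Lemma trmxC_hermsym (F : numClosedFieldType) n (X : 'M[F]_n) :
  X \is hermsymmx -> X ^t* = X.
Proof. by move/is_hermitianmxP => {2}->; rewrite expr0 scale1r. Qed.

Lemma hermsymmxE (F : numClosedFieldType) n (X : 'M[F]_n) :
  X ^t* = X -> X \is hermsymmx.
Proof. by move=> hX; apply/is_hermitianmxP; rewrite expr0 scale1r hX. Qed.

(** The [j]-th diagonal entry of the Gram matrix is the sum of the squared moduli of column [j], so
    each summand vanishes. *)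
Lemma gram_eq0 (F : numClosedFieldType) m n (X : 'M[F]_(m, n)) :
  X ^t* *m X = 0 -> X = 0.
Proof.
move=> /matrixP hX; apply/matrixP => i j; rewrite mxE.
have := hX j j; rewrite !mxE.
under eq_bigr => l _ do rewrite !mxE mulrC -normCK.
move/psumr_eq0P => h; apply/eqP; rewrite -normr_eq0 -sqrf_eq0.
by apply/eqP/h => // l _; rewrite exprn_ge0.
Qed.

Lemma gram_mul_eq0 (F : numClosedFieldType) m n p (X : 'M[F]_(m, n))
    (Z : 'M[F]_(n, p)) :
  X ^t* *m X *m Z = 0 -> X *m Z = 0.
Proof.
move=> h; apply: gram_eq0.
by rewrite trmxC_mul -!mulmxA mulmxA -(mulmxA (Z ^t*)) (mulmxA (X ^t*)) h mulmx0.
Qed.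

(** Whatever the Gram matrix kills, [X] kills too, and full column rank leaves only zero. *)
Lemma gram_unitmx (F : numClosedFieldType) m n (X : 'M[F]_(m, n)) :
  \rank X = n -> X ^t* *m X \in unitmx.
Proof.
move=> rkX; rewrite -row_full_unit -cokermx_eq0.
have /gram_mul_eq0 := mulmx_coker (X ^t* *m X).
move/(congr1 trmx); rewrite trmx_mul trmx0 => /eqP.
have freeXT : row_free X^T by rewrite /row_free mxrank_tr rkX.
by rewrite mulmx_free_eq0 // trmx_eq0.
Qed.

(** * Least squares on a subspace *)

Lemma normal_equation_solvable (F : numClosedFieldType) m n
    (W : 'M[F]_(m, n)) (s : 'cV[F]_m) :
  exists t : 'cV[F]_n, W ^t* *m W *m t = W ^t* *m s.
Proof.
have : ((W ^t* *m s)^T <= (W ^t* *m W)^T)%MS.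
  (* Solvability becomes a row-space inclusion after transposing; it is tested against the cokernel,
     so [W] may be rank deficient. *)
  rewrite submxE; set Z := cokermx _.
  have hZ : (W ^t* *m W)^T *m Z = 0 by apply: mulmx_coker.
  have WZ : (W ^t*)^T *m Z = 0.
    apply: gram_mul_eq0.
    (* The transposed Gram matrix of [W] is the Gram matrix of the entrywise conjugate of [W]. *)
    suff <- : (W ^t* *m W)^T = (W ^t*)^T ^t* *m (W ^t*)^T by [].
    rewrite trmx_mul trmxK -map_mx_comp [in RHS]map_mx_id // => a.
    exact: conjCK.
  by rewrite trmx_mul -mulmxA WZ mulmx0.
case/submxP => D hD; exists D^T.
by apply: trmx_inj; rewrite trmx_mul trmxK -hD.
Qed.

(** Gives a Krylov space matrix coordinates, so that the normal equations apply to it; the columns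
    of [V] are a basis. *)
Lemma vspace_colspan (F : fieldType) N (K : {vspace 'cV[F]_N}) :
  exists n (V : 'M[F]_(N, n)), forall y, y \in K <-> exists t, y = V *m t.
Proof.
pose V := \matrix_(i < N, j < \dim K) (vbasis K)`_j i 0.
have VE t : V *m t = \sum_j t j 0 *: (vbasis K)`_j.
  apply/colP => i; rewrite mxE summxE; apply: eq_bigr => j _.
  by rewrite !mxE mulrC.
exists (\dim K), V => y; split.
  move=> yK; exists (\col_j coord (vbasis K) j y).
  rewrite VE {1}(coord_vbasis yK).
  by apply: eq_bigr => j _; rewrite mxE.
case=> t ->; rewrite VE; apply: memv_suml => j _; apply/memvZ.
by apply: vbasis_mem; rewrite mem_nth // size_tuple.
Qed.

Lemma orthocv_self (F : numClosedFieldType) N (u : 'cV[F]_N) :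
  orthocv u u -> u = 0.
Proof. exact: gram_eq0. Qed.

Lemma orthocvBl (F : numClosedFieldType) N (u v w : 'cV[F]_N) :
  orthocv u w -> orthocv v w -> orthocv (u - v) w.
Proof. by rewrite /orthocv mulmxBr => -> ->; rewrite subrr. Qed.

Lemma least_squares_exists (F : numClosedFieldType) N (C : 'M[F]_N)
    (s : 'cV[F]_N) (K : {vspace 'cV[F]_N}) :
  exists2 y, y \in K & forall w, w \in K -> orthocv (s - C *m y) (C *m w).
Proof.
have [n [V VP]] := vspace_colspan K.
have [t ht] := normal_equation_solvable (C *m V) s.
exists (V *m t); first by apply/VP; exists t.
move=> _ /VP [u ->]; rewrite /orthocv mulmxA trmxC_mul -mulmxA mulmxBr.
by rewrite -ht !mulmxA subrr mulmx0.
Qed.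

(** * Krylov spaces and their grade *)

Section Krylov.
Variables (F : numClosedFieldType) (N : nat) (C : 'M[F]_N) (v : 'cV[F]_N).

Lemma krylov_sub n : (krylov C v n <= krylov C v n.+1)%VS.
Proof.
apply: sub_span => x xs; case/mapP: xs => i; rewrite mem_iota => /andP[_ lin] ->.
apply/mapP; exists i; rewrite // mem_iota.
by apply: leqW.
Qed.

Lemma krylov_gen i n : (i < n)%N -> C ^+ i *m v \in krylov C v n.
Proof. by move=> lin; apply/memv_span/mapP; exists i; rewrite // mem_iota. Qed.

Lemma krylov_mul n y : y \in krylov C v n -> C *m y \in krylov C v n.+1.
Proof.
move=> yK; pose f := linfun (mulmx C : 'cV[F]_N -> 'cV[F]_N).
have -> : C *m y = f y by rewrite lfunE.
suff /subvP : (f @: krylov C v n <= krylov C v n.+1)%VS.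
  by apply; apply: memv_img.
rewrite limg_span; apply/span_subvP => _ /mapP [x xs ->]; case/mapP: xs => i hi ->.
rewrite lfunE /= mulmxA -[C *m C ^+ i]/(C * C ^+ i) -exprS.
by apply: krylov_gen; move: hi; rewrite mem_iota.
Qed.

Lemma krylov_grade_exists : exists d, krylov_grade C v d.
Proof.
have ex : exists m, krylov C v m.+1 == krylov C v m.
  pose K m := krylov C v m.
  have [/existsP[i hi]|] := boolP [exists i : 'I_N.+1, K i.+1 == K i].
    by exists i.
  rewrite negb_exists => /forallP grow.
  (* If the first [N.+1] inclusions were all strict, each would raise the dimension, and [K N.+1]
     would exceed the ambient dimension [N]. *)
  have dimK m : (m <= N.+1)%N -> (m <= \dim (K m))%N.
    elim: m => // m IH ltmN; apply: (leq_ltn_trans (IH (ltnW ltmN))).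
    rewrite ltnNge; apply: contra (grow (Ordinal ltmN)) => dim_le.
    by rewrite eq_sym eqEdim krylov_sub.
  have := leq_trans (dimK _ (leqnn _)) (dimvS (subvf (K N.+1))).
  by rewrite dimvf /dim /= muln1 ltnn.
case: (ex_minnP ex) => d /eqP hd dmin; exists d; split=> // m /eqP.
exact: dmin.
Qed.

End Krylov.

(** * MINRES for a consistent Hermitian system *)

Section ConsistentMinres.
Variables (F : numClosedFieldType) (N : nat) (C : 'M[F]_N) (c z0 : 'cV[F]_N).
Hypotheses (hermC : C ^t* = C) (consC : exists w, c = C *m w).

Let s0 := c - C *m z0.

(** For Hermitian [C], [C (C w) = 0] reads [C^H C w = 0], which forces [C w = 0]. *)
Lemma hermitian_ker_range (y w : 'cV[F]_N) : y = C *m w -> C *m y = 0 -> y = 0.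
Proof.
move=> -> h; apply: gram_mul_eq0.
by rewrite hermC -mulmxA.
Qed.

Lemma residual_in_range z : exists w, c - C *m z = C *m w.
Proof. by case: consC => w ->; exists (w - z); rewrite mulmxBr. Qed.

(** Consistency gives [s0 = C w], and powers of [C] commute with [C]. *)
Lemma krylov_in_range n y : y \in krylov C s0 n -> exists w, y = C *m w.
Proof.
move=> yK; pose f := linfun (mulmx C : 'cV[F]_N -> 'cV[F]_N).
suff /subvP : (krylov C s0 n <= limg f)%VS.
  by move=> /(_ _ yK) /memv_imgP [w _ ->]; exists w; rewrite lfunE.
apply/span_subvP => x xs; case/mapP: xs => i _ ->.
have [w s0E] := residual_in_range z0.
rewrite /s0 s0E mulmxA -[C ^+ i *m C]/(C ^+ i * C) -exprSr exprS -mulmxA.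
by apply/memv_imgP; exists (C ^+ i *m w); rewrite ?memvf // lfunE.
Qed.

Lemma minres_iterate_init : minres_iterate C c z0 0 z0.
Proof.
split; rewrite ?subrr ?mem0v // => y.
by rewrite /krylov span_nil memv0 => /eqP ->; rewrite /orthocv mulmx0 trmx0 map_mx0 mul0mx.
Qed.

(** Subtracting the two orthogonality conditions makes [C (z - z')] orthogonal to itself, hence
    zero; [z - z'] lies in the range of [C], where [C] is injective. *)
Lemma minres_unique n z z' :
  minres_iterate C c z0 n z -> minres_iterate C c z0 n z' -> z = z'.
Proof.
move=> [zK zo] [z'K z'o].
have dK : z - z' \in krylov C s0 n.
  have -> : z - z' = (z - z0) - (z' - z0) by rewrite opprB addrA subrK.
  exact: rpredB.
apply/eqP; rewrite -subr_eq0; apply/eqP.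
have [w hw] := krylov_in_range dK; apply: hermitian_ker_range hw _.
apply: orthocv_self.
have := orthocvBl (z'o _ dK) (zo _ dK).
by rewrite opprB addrC addrA subrK -mulmxBr.
Qed.

Lemma minres_consistent_well_defined n : minres_well_defined C c z0 n.
Proof.
have [y yK yo] := least_squares_exists C s0 (krylov C s0 n).
have yI : minres_iterate C c z0 n (z0 + y).
  split=> [|w wK]; first by rewrite addrC addKr.
  by rewrite mulmxDr opprD addrA; apply: yo.
by exists (z0 + y); split=> // z'; apply: minres_unique.
Qed.

(* The final residual r lies in K_{d+1} = K_d, so C r lies in K_d as well;
   orthogonality to C K_d then gives <C r, C r> = <r, C (C r)> = 0. *)
Lemma minres_consistent_terminates d z :
  minres_last C c z0 d -> minres_iterate C c z0 d z -> C *m z = c.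
Proof.
move=> [Kd _] [zK zo]; set K := krylov C s0.
have CK y : y \in K d -> C *m y \in K d.
  by move=> yK; rewrite /K -Kd; apply: krylov_mul.
have s0K : s0 \in K d.
  by rewrite /K -Kd; have := krylov_gen C s0 (ltn0Sn d); rewrite expr0 mul1mx.
have rK : c - C *m z \in K d.
  have -> : c - C *m z = s0 - C *m (z - z0).
    by rewrite /s0 mulmxBr opprB addrA subrK.
  by rewrite rpredB // CK.
have [w hw] := residual_in_range z.
suff : c - C *m z = 0 by move/eqP; rewrite subr_eq0 => /eqP.
apply: (hermitian_ker_range hw); apply: orthocv_self.
have := zo _ (CK _ rK).
by rewrite /orthocv !trmxC_mul hermC -!mulmxA.
Qed.

End ConsistentMinres.

(** * Algebra of the deflation operators *)

Section DeflationIdentities.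
Variables (F : numClosedFieldType) (N k : nat).
Variables (A : 'M[F]_N) (U : 'M[F]_(N, k)).
Hypotheses (hermA : A ^t* = A).

Lemma deflG_gram : deflG A U = (A *m U) ^t* *m (A *m U).
Proof. by rewrite trmxC_mul hermA /deflG expr2 -!mulmxA. Qed.

Lemma deflG_unit : A \in unitmx -> \rank U = k -> deflG A U \in unitmx.
Proof.
move=> unitA rkU; rewrite deflG_gram; apply: gram_unitmx.
(* Multiplying by the invertible [A] keeps the rank of [U]; transposing moves [A] to the right,
   where row freeness applies. *)
by rewrite -mxrank_tr trmx_mul mxrankMfree ?mxrank_tr // row_free_unit unitmx_tr.
Qed.

Lemma deflM_herm : (deflM A U) ^t* = deflM A U.
Proof.
have hermG : (deflG A U) ^t* = deflG A U.
  by rewrite deflG_gram [LHS]trmxC_mul trmxCK.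
by rewrite /deflM !trmxC_mul trmxCK trmx_inv map_invmx hermG mulmxA.
Qed.

Lemma deflP_herm : (deflP A U) ^t* = deflP A U.
Proof.
rewrite /deflP linearB /= map_mxB trmx1 map_mx1 trmxC_mul hermA.
by rewrite (trmxC_mul A) hermA deflM_herm mulmxA.
Qed.

Lemma deflQ_trmxC : (deflQ A U) ^t* = 1%:M - A *m A *m deflM A U.
Proof.
rewrite /deflQ linearB /= map_mxB trmx1 map_mx1 expr2.
by rewrite trmxC_mul deflM_herm (trmxC_mul A A) hermA.
Qed.

Lemma defl_matrix_herm : (defl_matrix A U) ^t* = defl_matrix A U.
Proof.
by rewrite /defl_matrix trmxC_mul (trmxC_mul _ A) deflP_herm hermA mulmxA.
Qed.

(** After cancelling the common left factor [P], this is [Q^H = A P A^{-1}] applied to [b]. *)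
Lemma defl_consistent (b : 'cV[F]_N) :
  A \in unitmx -> defl_rhs A U b = defl_matrix A U *m (invmx A *m b).
Proof.
move=> unitA; rewrite /defl_rhs /defl_matrix -!mulmxA deflQ_trmxC /deflP.
congr (_ *m _); rewrite !(mulmxA, mulmxBl, mulmxBr, mul1mx, mulmx1).
by rewrite !mulmxV // mul1mx mulmxK.
Qed.

(** By [A Q = P A], the residual is [b - A M A b - P A A M b - P A P xbar]; the first two terms make
    [P b], and [P b - P A A M b = P Q^H b]. *)
Lemma defl_residual (b xbar : 'cV[F]_N) :
  b - A *m defl_correct A U b xbar
  = defl_rhs A U b - defl_matrix A U *m xbar.
Proof.
have AQ : A *m deflQ A U = deflP A U *m A.
  by rewrite /deflQ /deflP mulmxBr mulmxBl mulmx1 mul1mx expr2 !mulmxA.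
have Pb : deflP A U *m b = b - A *m deflM A U *m A *m b.
  by rewrite mulmxBl mul1mx.
rewrite /defl_correct /defl_rhs deflQ_trmxC /defl_matrix.
move: (deflP A U) (deflQ A U) (deflM A U) AQ Pb => P Q M AQ Pb.
rewrite mulmxDr mulmxA AQ mulmxDr mulmxBr mulmx1 mulmxBl Pb !mulmxA.
by rewrite [X in b - X]addrC [X in b - (_ + X)]addrC !opprD !addrA.
Qed.

End DeflationIdentities.

Theorem theorem6p1 (R : realType) (N k : nat)
    (A : 'M[R[i]]_N) (b : 'cV[R[i]]_N) (U : 'M[R[i]]_(N, k))
    (hA : A \is hermsymmx) (hA1 : A \in unitmx)
    (hk : (0 < k < N)%N) (hU : \rank U = k) :
  deflG A U \in unitmx
  /\ defl_matrix A U \is hermsymmx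
  /\ forall x0 : 'cV[R[i]]_N,
     exists d : nat,
       minres_last (defl_matrix A U) (defl_rhs A U b) x0 d
       /\ (forall n : nat, (1 <= n <= d)%N ->
             minres_well_defined (defl_matrix A U) (defl_rhs A U b) x0 n)
       /\ (forall xbar : nat -> 'cV[R[i]]_N,
             minres_run (defl_matrix A U) (defl_rhs A U b) x0 d xbar ->
             let x := fun n : nat => defl_correct A U b (xbar n) in
             defl_matrix A U *m xbar d = defl_rhs A U b
             /\ A *m x d = b
             /\ forall n : nat, (n <= d)%N ->
                  b - A *m x n = defl_rhs A U b - defl_matrix A U *m xbar n).
Proof.
have hermA := trmxC_hermsym hA.
have hermB := defl_matrix_herm U hermA.
have consB : exists w, defl_rhs A U b = defl_matrix A U *m w.
  by exists (invmx A *m b); apply: defl_consistent.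
split; first exact: deflG_unit.
split; first exact: hermsymmxE.
move=> x0.
have [d hd] := krylov_grade_exists (defl_matrix A U)
                 (defl_rhs A U b - defl_matrix A U *m x0).
exists d; split=> //; split=> [n _|xbar [xbar0 run] x].
  exact: minres_consistent_well_defined.
have sol : defl_matrix A U *m xbar d = defl_rhs A U b.
  apply: (minres_consistent_terminates hermB consB hd).
  (* When [d = 0] the run imposes no condition beyond its starting value, so [x0] itself must serve
     as the iterate at step 0. *)
  case: d {hd} run => [|d] run; last by apply: run; rewrite leqnn.
  by rewrite xbar0; apply: minres_iterate_init.
have res n : b - A *m x n = defl_rhs A U b - defl_matrix A U *m xbar n.
  exact: defl_residual.
(* At step [d] the deflated residual is zero, and it equals the residual of the original system. *)
split=> //; split=> //; apply/esym/eqP; rewrite -subr_eq0.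
by rewrite res sol subrr.
Qed.
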